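(* Let $\mathcal{D}$ be a convex subset of $\mathbb{R}^n$. The following statements are valid: (a) The square of a dc function on $\mathcal{D}$ is dc on $\mathcal{D}$. (b) The product of two dc functions on $\mathcal{D}$ is dc on $\mathcal{D}$. (c) Let $f_i(x)=g_i(x)-h_i(x)$ be a dc decomposition of $f_i$ on $\mathcal{D}$ ($g_i,h_i$ convex on $\mathcal{D}$), for $i=1,\dots,I$. Then $\|F(x)\|_2$ is a dc function on $\mathcal{D}$, where $F(x)=(f_i(x))_{i=1}^I$.
   Context: A function on a convex set $\mathcal{D}$ is dc (difference-of-convex) if it is the difference of two real-valued convex functions on $\mathcal{D}$. $\|\cdot\|_2$ is the Euclidean norm. *)

(* Defs.v *)
From HB Require Import structures.
From mathcomp Require Import all_boot all_order all_algebra.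
From mathcomp Require Import all_classical all_reals.
From mathcomp Require Import convex.

Set Implicit Arguments.
Unset Strict Implicit.
Unset Printing Implicit Defensive.

Import Order.TTheory GRing.Theory Num.Theory.

Local Open Scope classical_set_scope.
Local Open Scope ring_scope.

(* A function on D is represented by a function on the whole space, of which
   only the values on D are constrained. *)
Definition dc_decomposition (R : realType) (n : nat) (D : set 'rV[R]_n)
    (f g h : 'rV[R]_n -> R) : Prop :=
  [/\ convex_function D g, convex_function D h &
      forall x, D x -> f x = g x - h x].

Definition dc_on (R : realType) (n : nat) (D : set 'rV[R]_n)
    (f : 'rV[R]_n -> R) : Prop :=
  exists g h : 'rV[R]_n -> R, dc_decomposition D f g h.

(* The library's norm on matrices is the sup norm, not the Euclidean one. *)
Definition norm2 (R : realType) (m : nat) (v : 'rV[R]_m) : R :=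
  Num.sqrt (\sum_(i < m) v ord0 i ^+ 2).

(* Main.v *)
(* Adding one convex function [k] to both terms of [f = g - h] makes them
   nonnegative on [D] as soon as [k >= -g] and [k >= -h]. Such a [k] exists
   because a convex function on a convex set of finite dimension decreases at
   most linearly. Squares of nonnegative convex functions are convex, so products are dc by
   polarization. *)
Require Import Defs.
From HB Require Import structures.
From mathcomp Require Import all_boot all_order all_algebra.
From mathcomp Require Import all_classical all_reals.
From mathcomp Require Import convex.
From mathcomp Require Import ring lra interval_inference.

Set Implicit Arguments.
Unset Strict Implicit.
Unset Printing Implicit Defensive.

Import Order.TTheory GRing.Theory Num.Theory.

Local Open Scope classical_set_scope.
Local Open Scope ring_scope.

(** * Convexity with a real parameter *)

Lemma convex_setP (R : realType) (E : lmodType R) (D : set E) :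
  convex_set D <->
  (forall (x y : E) (t : R), D x -> D y -> 0 <= t <= 1 ->
    D (t *: x + (1 - t) *: y)).
Proof.
split=> [cD x y t Dx Dy t01|cD x y t /set_mem Dx /set_mem Dy].
- have /andP[t0 t1] := t01.
  exact: set_mem (cD x y (Itv01 t0 t1) (mem_set Dx) (mem_set Dy)).
- apply/mem_set; apply: (cD x y t%:num) => //; by rewrite ge0 le1.
Qed.

Lemma convex_functionP (R : realType) (E : lmodType R) (D : set E)
    (f : E -> R) :
  convex_function D f <->
  (forall (x y : E) (t : R), D x -> D y -> 0 <= t <= 1 ->
    f (t *: x + (1 - t) *: y) <= t * f x + (1 - t) * f y).
Proof.
split=> [cf x y t Dx Dy t01|cf t x y /set_mem Dx /set_mem Dy].
- have /andP[t0 t1] := t01.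
  exact: (cf (Itv01 t0 t1) x y (mem_set Dx) (mem_set Dy)).
- by apply: cf => //; rewrite ge0 le1.
Qed.

(** * Affine generators and weighted Jensen *)

(* The rows [(1, x)] homogenize affine combinations: if the rows of [P] are in
   [D] and [(1, P)] has maximal rank, they affinely span [D], and the coordinates
   [(1, x) *m A] of [x] depend affinely on [x]. *)
Lemma affine_generators (F : fieldType) (n : nat) (D : set 'rV[F]_n) :
  exists (m : nat) (P : 'M[F]_(m, n)) (A : 'M[F]_(1 + n, m)),
    (forall i, D (row i P)) /\
    (forall x, D x ->
      row_mx (const_mx 1) x *m A *m row_mx (const_mx 1) P =
      row_mx (const_mx 1) x :> 'M_(1, 1 + n)).
Proof.
pose aug m (P : 'M[F]_(m, n)) : 'M_(m, 1 + n) := row_mx (const_mx 1) P.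
(* [k] ranges over the ranks of homogenized families from [D], bounded by [1 + n]; the empty family
   makes the range nonempty even when [D] is empty. *)
pose rk k := `[< exists m (P : 'M_(m, n)),
  (forall i, D (row i P)) /\ \rank (aug m P) = k >].
have rk0 : exists k, rk k.
  exists (\rank (aug 0%N 0)); apply/asboolP; exists 0%N, 0.
  by split=> // -[].
have rk_le k : rk k -> (k <= 1 + n)%N.
  by move=> /asboolP[m [P [_ <-]]]; exact: rank_leq_col.
have [_ /asboolP[m [P [DP <-]]] maxP] := ex_maxnP rk0 rk_le.
exists m, P, (pinvmx (aug m P)); split=> // x Dx; apply: mulmxKpV.
have augE : aug _ (col_mx P x) = col_mx (aug _ P) (aug _ x).
  by rewrite /aug -block_mxEv block_mxEh col_mx_const.
have subP : (aug _ P <= aug _ (col_mx P x))%MS.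
  by rewrite augE -addsmxE addsmxSl.
(* By maximality of the rank, appending the row [x] does not enlarge the row space. *)
suff : (aug _ (col_mx P x) <= aug _ P)%MS.
  by rewrite augE col_mx_sub => /andP[].
rewrite -(mxrank_leqif_sup subP) eqn_leq mxrankS//=.
apply: maxP; apply/asboolP; exists (m + 1)%N, (col_mx P x); split=> // i.
rewrite -[i]splitK; case: (fintype.split i) => j /=.
  by rewrite rowKu.
by rewrite rowKd row_id.
Qed.

(* Jensen's inequality for weights that need not sum to [1], where it says that
   the epigraph of the perspective of [f] is closed under addition. *)
Lemma jensen_sum (R : realType) (E : lmodType R) (D : set E)
    (f : E -> R) (m : nat) (w : 'I_m -> R) (p : 'I_m -> E) :
  convex_set D -> convex_function D f -> D !=set0 ->
  (forall i, 0 <= w i) -> (forall i, D (p i)) ->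
  exists y, [/\ D y, \sum_i w i *: p i = (\sum_i w i) *: y &
    (\sum_i w i) * f y <= \sum_i w i * f (p i)].
Proof.
move=> /convex_setP cD /convex_functionP cf [x0 Dx0] w_ge0 Dp.
pose K (s : R) v (t : R) :=
  0 <= s /\ exists y, [/\ D y, v = s *: y & s * f y <= t].
suff: K (\sum_i w i) (\sum_i w i *: p i) (\sum_i w i * f (p i)) by case.
apply: (big_ind3 K) => [||i _]; last by split=> //; exists (p i).
  by split=> //; exists x0; rewrite scale0r mul0r.
move=> s1 _ t1 s2 _ t2 [s1_ge0 [y1 [Dy1 -> le1]]] [s2_ge0 [y2 [Dy2 -> le2]]].
split; first exact: addr_ge0.
(* With zero total weight both summands vanish, and any point of [D] serves. *)
have [/eqP|s_neq0] := eqVneq (s1 + s2) 0.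
  rewrite paddr_eq0// => /andP[/eqP s10 /eqP s20].
  exists x0; move: le1 le2.
  rewrite s10 s20 !addr0 !scale0r addr0 !mul0r => le1 le2.
  by split=> //; exact: addr_ge0.
have s_gt0 : 0 < s1 + s2 by rewrite lt_def s_neq0 addr_ge0.
have t01 : 0 <= s1 / (s1 + s2) <= 1.
  by rewrite divr_ge0 ?(ltW s_gt0)//= ler_pdivrMr// mul1r lerDl.
have sl : (s1 + s2) * (s1 / (s1 + s2)) = s1 by rewrite mulrC divfK.
have sr : (s1 + s2) * (1 - s1 / (s1 + s2)) = s2.
  by rewrite mulrBr sl mulr1 addrAC subrr add0r.
exists ((s1 / (s1 + s2)) *: y1 + (1 - s1 / (s1 + s2)) *: y2).
split; first exact: cD.
  by rewrite scalerDr !scalerA sl sr.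
have /(ler_wpM2l (ltW s_gt0)) := cf _ _ _ Dy1 Dy2 t01.
rewrite mulrDr !(mulrA _ _ (f _)) sl sr; lra.
Qed.

(** * Operations preserving convexity *)

Lemma convex_functionD (R : realType) (E : lmodType R) (D : set E)
    (f g : E -> R) :
  convex_function D f -> convex_function D g ->
  convex_function D (fun x => f x + g x).
Proof.
move=> /convex_functionP cf /convex_functionP cg; apply/convex_functionP.
move=> x y t Dx Dy t01.
have := cf _ _ _ Dx Dy t01; have := cg _ _ _ Dx Dy t01; lra.
Qed.

Lemma convex_functionZ (R : realType) (E : lmodType R) (D : set E)
    (c : R) (f : E -> R) :
  0 <= c -> convex_function D f -> convex_function D (fun x => c * f x).
Proof.
move=> c0 /convex_functionP cf; apply/convex_functionP => x y t Dx Dy t01.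
by have /(ler_wpM2l c0) := cf _ _ _ Dx Dy t01; lra.
Qed.

Lemma convex_function_sum (R : realType) (E : lmodType R) (D : set E)
    (m : nat) (f : 'I_m -> E -> R) :
  (forall i, convex_function D (f i)) ->
  convex_function D (fun x => \sum_i f i x).
Proof.
move=> cf; apply/convex_functionP => x y t Dx Dy t01.
rewrite !mulr_sumr -big_split /=; apply: ler_sum => i _.
by have /convex_functionP := cf i; apply.
Qed.

(** Squaring is monotone on nonnegative values; what remains is the gap
    [t * (1 - t) * (f x - f y) ^+ 2]. *)
Lemma convex_function_sqr (R : realType) (E : lmodType R) (D : set E)
    (f : E -> R) :
  convex_set D -> convex_function D f -> (forall x, D x -> 0 <= f x) ->
  convex_function D (fun x => f x ^+ 2).
Proof.
move=> /convex_setP cD /convex_functionP cf f0; apply/convex_functionP.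
move=> x y t Dx Dy t01.
have le_f := cf _ _ _ Dx Dy t01.
have fz0 := f0 _ (cD _ _ _ Dx Dy t01).
apply: (@le_trans _ _ ((t * f x + (1 - t) * f y) ^+ 2)).
  by rewrite ler_sqr ?nnegrE//; apply: le_trans le_f.
rewrite -subr_ge0.
have -> : t * f x ^+ 2 + (1 - t) * f y ^+ 2 - (t * f x + (1 - t) * f y) ^+ 2 =
  t * (1 - t) * (f x - f y) ^+ 2 by ring.
by have /andP[t0 t1] := t01; rewrite mulr_ge0 ?sqr_ge0// mulr_ge0// subr_ge0.
Qed.

(** * Convex majorant of the opposite of a convex function *)

(* Let [b] be the barycenter of affine generators [p i] of [D], and [a i x] the
   affine coordinates of [x]. For [N x = m * \sum_i `|a i x|], [b] is a convex
   combination of [x], with weight [1 / (1 + N x)], and of the [p i], with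
   weights [1 / m - a i x / (1 + N x) >= 0], so Jensen gives
   [- f x <= C * (1 + N x)]. *)
Lemma convex_majorant_opp (R : realType) (n : nat) (D : set 'rV[R]_n)
    (f : 'rV[R]_n -> R) :
  convex_set D -> convex_function D f ->
  exists k : 'rV[R]_n -> R, convex_function D k /\
    forall x, D x -> 0 <= k x /\ - f x <= k x.
Proof.
move=> cD cf.
have [D0|D_empty] := pselect (D !=set0); last first.
  exists (fun=> 0); split=> [|x Dx]; last by case: D_empty; exists x.
  by move=> t x y /set_mem Dx; case: D_empty; exists x.
have [m [P [A [DP AP]]]] := affine_generators D.
have [a [a_conv aQ]] : exists a : 'rV[R]_n -> 'rV[R]_m,
    (forall x y t, a (t *: x + (1 - t) *: y) = t *: a x + (1 - t) *: a y) /\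
    (forall x, D x ->
      a x *m row_mx (const_mx 1) P = row_mx (const_mx 1 : 'rV_1) x).
  exists (fun x => row_mx (const_mx 1) x *m A); split=> // x y t.
  rewrite 2!scalemxAl -mulmxDl !scale_row_mx add_row_mx.
  by congr (row_mx _ _ *m _); apply/rowP => i; rewrite !mxE; ring.
have aP x : D x -> \sum_i a x 0 i = 1 /\ \sum_i a x 0 i *: row i P = x.
  move=> /aQ; rewrite mul_mx_row => /eq_row_mx[/rowP/(_ 0) a1 aE].
  split; last by rewrite -mulmx_sum_row.
  by move: a1; rewrite !mxE => <-; apply: eq_bigr => i _; rewrite mxE mulr1.
(* The coordinates of a point of [D] sum to [1], so the family is not empty. *)
have m_gt0 : 0 < m%:R :> R.
  rewrite ltr0n lt0n; apply/negP => /eqP m0; have [x /aP[]] := D0.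
  rewrite big1 => [/esym/eqP|i _]; first by rewrite oner_eq0.
  by have := ltn_ord i; rewrite [X in (_ < X)%N]m0.
pose N x : R := m%:R * \sum_i `|a x 0 i|.
have N_ge0 x : 0 <= N x by rewrite mulr_ge0// sumr_ge0.
have mV_ge0 : 0 <= m%:R^-1 :> R by rewrite invr_ge0.
have sum_mV : \sum_(i < m) m%:R^-1 = 1 :> R.
  by rewrite sumr_const card_ord -(mulr_natl m%:R^-1) divff ?gt_eqF.
have [b [Db + _]] := @jensen_sum _ _ D f m (fun=> m%:R^-1)
  (fun i => row i P) cD cf D0 (fun=> mV_ge0) DP.
rewrite sum_mV scale1r => bE.
(* The first term bounds [- f b]; the sum bounds the Jensen terms, whose weights [w i] lie between
   [0] and [2]. *)
pose C : R := `|f b| + \sum_i 2 * `|f (row i P)|.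
have C_ge0 : 0 <= C.
  by rewrite addr_ge0// sumr_ge0// => i _; rewrite mulr_ge0.
exists (fun x => C * (1 + N x)); split=> [|x Dx].
  apply: convex_functionZ => //; apply/convex_functionP => x y t _ _ t01.
  suff: N (t *: x + (1 - t) *: y) <= t * N x + (1 - t) * N y by lra.
  have /andP[t0 t1] := t01.
  rewrite /N ![_ * (m%:R * _)]mulrCA -mulrDr ler_wpM2l//.
  rewrite !mulr_sumr -big_split ler_sum//= => i _.
  rewrite a_conv !mxE (le_trans (ler_normD _ _))//.
  by rewrite !normrM (ger0_norm t0) (@ger0_norm _ (1 - t)) ?subr_ge0.
have N1_gt0 : 0 < 1 + N x by rewrite ltr_pwDl.
split; first by rewrite mulr_ge0// ltW.
pose t := (1 + N x)^-1.
have t_gt0 : 0 < t by rewrite invr_gt0.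
have tN : t * (1 + N x) = 1 by rewrite mulVf// gt_eqF.
have t01 : 0 <= t <= 1 by rewrite ltW//= invf_le1// lerDl.
pose w i := m%:R^-1 - t * a x 0 i.
have ta_le i : t * `|a x 0 i| <= m%:R^-1.
  rewrite -(ler_pM2l m_gt0) divff ?gt_eqF// -[X in _ <= X]tN mulrCA ler_pM2l//.
  have : m%:R * `|a x 0 i| <= N x.
    by rewrite ler_pM2l// (bigD1 i)//= lerDl sumr_ge0.
  lra.
have w_ge0 i : 0 <= w i.
  by rewrite subr_ge0 (le_trans _ (ta_le i))// ler_pM2l// ler_norm.
have w_le2 i : w i <= 2.
  have := ta_le i; have : - (t * a x 0 i) <= t * `|a x 0 i|.
    by rewrite -mulrN ler_pM2l// -normrN ler_norm.
  have : m%:R^-1 <= 1 :> R by rewrite invf_le1// ler1n -(ltr0n R).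
  rewrite /w; lra.
have [a1 aE] := aP _ Dx.
(* The weights [w i] total [1 - t], so [b = t *: x + (1 - t) *: y]; convexity at [b] then bounds
   [f x] from below. *)
have [y [Dy]] := jensen_sum cD cf D0 w_ge0 DP.
have -> : \sum_i w i = 1 - t.
  by rewrite sumrB sum_mV -mulr_sumr a1 mulr1.
have -> : \sum_i w i *: row i P = b - t *: x.
  rewrite -[b]bE -[in RHS]aE scaler_sumr -sumrB; apply: eq_bigr => i _.
  by rewrite scalerBl scalerA.
move=> /eqP; rewrite subr_eq addrC => /eqP byE le_y.
move/convex_functionP: (cf) => /(_ _ _ _ Dx Dy t01); rewrite -byE => le_b.
have le_w : \sum_i w i * f (row i P) <= \sum_i 2 * `|f (row i P)|.
  apply: ler_sum => i _; apply: (@le_trans _ _ (w i * `|f (row i P)|)).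
    by rewrite ler_wpM2l// ler_norm.
  by rewrite ler_wpM2r.
rewrite -(ler_pM2l t_gt0) mulrCA tN mulr1 mulrN /C.
have := ler_norm (- f b); rewrite normrN; lra.
Qed.

(** * Nonnegative decompositions and products *)

Lemma dc_on_ge0 (R : realType) (n : nat) (D : set 'rV[R]_n)
    (f : 'rV[R]_n -> R) :
  convex_set D -> dc_on D f ->
  exists g h : 'rV[R]_n -> R, dc_decomposition D f g h /\
    forall x, D x -> 0 <= g x /\ 0 <= h x.
Proof.
move=> cD [g [h [cg ch fE]]].
have [k [ck kP]] := convex_majorant_opp cD cg.
have [l [cl lP]] := convex_majorant_opp cD ch.
have ckl := convex_functionD ck cl.
(* Both majorants are nonnegative on [D], so [k + l] dominates [- g] and [- h] at once. *)
exists (fun x => g x + (k x + l x)), (fun x => h x + (k x + l x)).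
split=> [|x Dx]; last by have := kP _ Dx; have := lP _ Dx; lra.
split; [exact: convex_functionD..|].
by move=> x /fE ->; ring.
Qed.

(* With nonnegative decompositions, [(g1 - h1) (g2 - h2)] is half of
   [(g1 + g2)^2 + (h1 + h2)^2 - (g1 + h2)^2 - (h1 + g2)^2]. *)
Lemma dc_onM (R : realType) (n : nat) (D : set 'rV[R]_n)
    (f1 f2 : 'rV[R]_n -> R) :
  convex_set D -> dc_on D f1 -> dc_on D f2 -> dc_on D (fun x => f1 x * f2 x).
Proof.
move=> cD /(dc_on_ge0 cD)[g1 [h1 [[cg1 ch1 fE1] ge1]]].
move=> /(dc_on_ge0 cD)[g2 [h2 [[cg2 ch2 fE2] ge2]]].
exists (fun x => 2^-1 * ((g1 x + g2 x) ^+ 2 + (h1 x + h2 x) ^+ 2)).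
exists (fun x => 2^-1 * ((g1 x + h2 x) ^+ 2 + (h1 x + g2 x) ^+ 2)).
split=> [||x Dx]; last by rewrite fE1// fE2//; field.
all: apply: convex_functionZ => //; apply: convex_functionD.
all: apply: convex_function_sqr => //; first exact: convex_functionD.
all: move=> x Dx; have := ge1 _ Dx; have := ge2 _ Dx; lra.
Qed.

(** * Euclidean norm of a dc map *)

(** Cauchy-Schwarz for [u] in the unit ball. *)
Lemma sum_mul_le_norm2 (R : realType) (m : nat) (u v : 'rV[R]_m) :
  norm2 u <= 1 -> \sum_i u 0 i * v 0 i <= norm2 v.
Proof.
rewrite /norm2 -[X in _ <= X]sqrtr1 ler_sqrt// => u1.
set S := \sum_i v _ i ^+ 2; set s := Num.sqrt S.
have S_ge0 : 0 <= S by rewrite sumr_ge0// => i _; rewrite sqr_ge0.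
have s_ge0 : 0 <= s by exact: sqrtr_ge0.
have sS : s ^+ 2 = S by rewrite sqr_sqrtr.
have [s0|s_neq0] := eqVneq s 0.
  have v0 i : v 0 i = 0.
    have /eqP := sS; rewrite s0 expr0n /= eq_sym psumr_eq0; last first.
      by move=> j _; rewrite sqr_ge0.
    by move=> /allP /(_ i (mem_index_enum _)) /=; rewrite sqrf_eq0 => /eqP.
  by rewrite s0 big1// => i _; rewrite v0 mulr0.
have s_gt0 : 0 < s by rewrite lt_def s_neq0.
rewrite -(ler_pM2l s_gt0) -expr2 sS mulr_sumr.
(* AM-GM: [2 s u v <= s^2 u^2 + v^2] *)
have : \sum_i s * (u 0 i * v 0 i) <=
    \sum_i 2^-1 * (s ^+ 2 * u ord0 i ^+ 2 + v ord0 i ^+ 2).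
  apply: ler_sum => i _; have := sqr_ge0 (s * u 0 i - v 0 i); lra.
rewrite -[X in _ <= X -> _]mulr_sumr big_split /=.
rewrite -[X in X + _]mulr_sumr -/S sS.
have := ler_wpM2l S_ge0 u1; lra.
Qed.

(* [norm2 F + \sum_i (g i + h i)] is convex, being the supremum over the vectors
   [u] with [norm2 u <= 1] of
   [U u = \sum_i ((1 + u i) * g i + (1 - u i) * h i)].
   At [z] it is attained at [u = F z / norm2 (F z)], which is [0] if [F z = 0]
   because [0^-1 = 0]. *)
Lemma dc_on_norm2 (R : realType) (n : nat) (D : set 'rV[R]_n) (I : nat)
    (f g h : 'I_I -> 'rV[R]_n -> R) :
  convex_set D -> (forall i, dc_decomposition D (f i) (g i) (h i)) ->
  dc_on D (fun x => norm2 (\row_(i < I) f i x)).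
Proof.
move=> /convex_setP cD dcf.
have cg i : convex_function D (g i) by case: (dcf i).
have ch i : convex_function D (h i) by case: (dcf i).
have fE i x : D x -> f i x = g i x - h i x by case: (dcf i) => _ _; apply.
pose F x := \row_(i < I) f i x.
pose S x := \sum_i (g i x + h i x).
exists (fun x => norm2 (F x) + S x), S; split=> [||x _]; last by rewrite addrK.
  pose U (u : 'rV_I) x :=
    \sum_i ((1 + u ord0 i) * g i x + (1 - u ord0 i) * h i x).
  have UE u x : D x -> U u x = \sum_i u ord0 i * F x ord0 i + S x.
    move=> Dx; rewrite /U /S -big_split; apply: eq_bigr => i _ /=.
    by rewrite mxE fE//; ring.
  have U_le u x : norm2 u <= 1 -> D x -> U u x <= norm2 (F x) + S x.
    by move=> u1 Dx; rewrite UE// lerD2r sum_mul_le_norm2.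
  (* Each entry of [u] is at most [1] in absolute value, so the coefficients [1 + u i] and [1 - u i]
     are nonnegative. *)
  have cU u : norm2 u <= 1 -> convex_function D (U u).
    move=> u1; have u_le i : `|u ord0 i| <= 1.
      apply: le_trans u1; rewrite -sqrtr_sqr /norm2 ler_wsqrtr//.
      by rewrite (bigD1 i)//= lerDl sumr_ge0// => j _; rewrite sqr_ge0.
    apply: convex_function_sum => i; have := u_le i; rewrite ler_norml => ui.
    by apply: convex_functionD; apply: convex_functionZ => //; lra.
  apply/convex_functionP => x y t Dx Dy t01.
  set z := t *: x + _; have Dz : D z by exact: cD.
  pose u := (norm2 (F z))^-1 *: F z.
  have sumF : \sum_i F z ord0 i ^+ 2 = norm2 (F z) ^+ 2.
    by rewrite sqr_sqrtr// sumr_ge0// => i _; rewrite sqr_ge0.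
  have N_ge0 : 0 <= norm2 (F z) by exact: sqrtr_ge0.
  have u1 : norm2 u <= 1.
    rewrite -[X in _ <= X]sqrtr1 ler_wsqrtr//.
    under eq_bigr do rewrite mxE exprMn.
    rewrite -mulr_sumr sumF -exprMn.
    have [->|N0] := eqVneq (norm2 (F z)) 0; first by rewrite mulr0 expr0n.
    by rewrite mulVf// expr1n.
  have uF : \sum_i u ord0 i * F z ord0 i = norm2 (F z).
    under eq_bigr do rewrite mxE -mulrA -expr2.
    rewrite -mulr_sumr sumF expr2 mulrA.
    have [->|N0] := eqVneq (norm2 (F z)) 0; first by rewrite mulr0.
    by rewrite mulVf// mul1r.
  (* [U u] is convex, attains the target function at [z] and lies below it at [x] and [y]. *)
  have /convex_functionP := cU _ u1; move=> /(_ _ _ _ Dx Dy t01).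
  rewrite -/z UE// uF => /le_trans; apply.
  have /andP[t0 t1] := t01.
  by rewrite lerD// ler_wpM2l ?subr_ge0// U_le.
by apply: convex_function_sum => i; exact: convex_functionD.
Qed.

Theorem lemma3 (R : realType) (n : nat) (D : set 'rV[R]_n)
    (convexD : convex_set D) :
  [/\ (forall f : 'rV[R]_n -> R,
         dc_on D f -> dc_on D (fun x => f x ^+ 2)),
      (forall f1 f2 : 'rV[R]_n -> R,
         dc_on D f1 -> dc_on D f2 -> dc_on D (fun x => f1 x * f2 x))
    & (forall (I : nat) (f g h : 'I_I -> 'rV[R]_n -> R),
         (forall i : 'I_I, dc_decomposition D (f i) (g i) (h i)) ->
         dc_on D (fun x => norm2 (\row_(i < I) f i x)))].
Proof.
split=> [f dcf|f1 f2|I f g h].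
(* The square is, by computation, the product of [f] with itself. *)
- exact: dc_onM.
- exact: dc_onM.
- exact: dc_on_norm2.
Qed.
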